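(* Let $K,L\in\mathbb{N}_+$ with $L\ge3$. Let $(x_i,y_i)_{i=1}^K\subseteq\mathbb{R}^2$ with $x_1<x_2<\cdots<x_K$, and let $n_1,\dots,n_L\in\mathbb{N}_+$ with $n_b>11$ for all $b$, satisfying $$K\le\sum_{b=1}^{L-1}\left((n_b-11)\left\lfloor\frac{n_{b+1}-9}{4}\right\rfloor-2\right).$$ Then there exists a ReLU MLP $\Phi:\mathbb{R}\to\mathbb{R}$ with $\operatorname{widthvec}(\Phi)=[n_1,n_2,\dots,n_L,8]$ such that $$\Phi(x_i)=y_i\qquad\text{for }i=1,\dots,K.$$ Furthermore, $\Phi$ is linear (affine) on each interval $[x_i,x_{i+1}]$, $i=1,\dots,K-1$, and constant on each of $(-\infty,x_1]$ and $[x_K,\infty)$. The number of nonzero parameters in $\Phi$ is at most $$2K+23\sum_{b=1}^L n_b-121L.$$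
   Context: ReLU MLP: a function $\Phi:\mathbb{R}^{d_1}\to\mathbb{R}^{d_{\Delta+1}}$ with a representation $\mathbf{x}^{(1)}=\mathbf{x}$, $\mathbf{x}^{(l+1)}=\operatorname{ReLU}(\mathbf{W}^{(l)}\mathbf{x}^{(l)}+\mathbf{b}^{(l)})$ for $l=1,\dots,\Delta-1$ (ReLU$(t)=\max\{0,t\}$ applied componentwise), $\Phi(\mathbf{x})=\mathbf{W}^{(\Delta)}\mathbf{x}^{(\Delta)}+\mathbf{b}^{(\Delta)}$, where $\mathbf{W}^{(l)}\in\mathbb{R}^{d_{l+1}\times d_l}$ and $\mathbf{b}^{(l)}\in\mathbb{R}^{d_{l+1}}$. $\operatorname{widthvec}(\Phi)=[d_2,\dots,d_\Delta]$ is the list of hidden layer widths, and the number of nonzero parameters is the total number of nonzero entries of all $\mathbf{W}^{(l)},\mathbf{b}^{(l)}$. *)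

(* Defs.v *)
From mathcomp Require Import all_boot all_order all_algebra.
From mathcomp Require Import reals.

Set Implicit Arguments.
Unset Strict Implicit.
Unset Printing Implicit Defensive.

Import Order.TTheory GRing.Theory Num.Theory.
Local Open Scope ring_scope.

Definition relu (R : realType) (t : R) : R := Num.max 0 t.

(** A representation (list of weights and biases) of a ReLU MLP from R^d to
    R^e. The input dimension is an index because it changes from one layer to
    the next; the final affine map is not followed by a ReLU. *)
Inductive relu_mlp (R : realType) (e : nat) : nat -> Type :=
| Output d (W : 'M[R]_(e, d)) (b : 'cV[R]_e) : relu_mlp R e d
| Hidden d h (W : 'M[R]_(h, d)) (b : 'cV[R]_h) (Phi : relu_mlp R e h) :
    relu_mlp R e d.

Fixpoint mlp_eval (R : realType) (e d : nat) (Phi : relu_mlp R e d) :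
    'cV[R]_d -> 'cV[R]_e :=
  match Phi with
  | Output _ W b => fun v => W *m v + b
  | Hidden _ _ W b Psi =>
      fun v => mlp_eval Psi (map_mx (@relu R) (W *m v + b))
  end.

Definition mlp_fun (R : realType) (Phi : relu_mlp R 1 1) (t : R) : R :=
  mlp_eval Phi (const_mx t) 0 0.

Fixpoint widthvec (R : realType) (e d : nat) (Phi : relu_mlp R e d) : seq nat :=
  match Phi with
  | Output _ _ _ => [::]
  | Hidden _ h _ _ Psi => h :: widthvec Psi
  end.

Definition mx_nnz (R : realType) (m n : nat) (A : 'M[R]_(m, n)) : nat :=
  #|[set ij : 'I_m * 'I_n | A ij.1 ij.2 != 0]|.

Fixpoint nb_nonzero_params (R : realType) (e d : nat) (Phi : relu_mlp R e d) :
    nat :=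
  match Phi with
  | Output _ W b => (mx_nnz W + mx_nnz b)%N
  | Hidden _ _ W b Psi => (mx_nnz W + mx_nnz b + nb_nonzero_params Psi)%N
  end.

Definition affine_on (R : realType) (f : R -> R) (I : interval R) : Prop :=
  exists a c : R, {in I, forall t, f t = a * t + c}.

Definition constant_on (R : realType) (f : R -> R) (I : interval R) : Prop :=
  exists c : R, {in I, forall t, f t = c}.

(* Main.v *)
Require Import Defs.
From mathcomp Require Import all_boot all_order all_algebra.
From mathcomp Require Import reals boolp.
From mathcomp Require Import zify ring lra.

(** Cut [x_1, x_K] into L - 1 consecutive regions [A_b, A_(b+1)], the b-th one
    holding at most (n_b - 11) * floor ((n_(b+1) - 9) / 4) - 2 steps between
    consecutive data points.  Every neuron of layer b plays two roles: on region
    b it is a coarse ramp (x - t)_+, and on region b - 1 it is the positive part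
    of a zigzag with coarse knots, which adds kinks of the interpolant f at the
    zeros of the zigzag; it vanishes at A_b, where the two roles meet.  Inside
    the i-th coarse interval the j-th fine data point is the zero of exactly one
    of four zigzags, chosen by the parity of i and the sign of the kink; since
    the intervals used by one zigzag are not adjacent and its slopes alternate in
    sign, it has no other zeros, and each kink costs only two nonzero weights.

    Five further neurons per layer carry (x - A_b)_+ and (A_b - x)_+, which
    silence a layer outside the region it is meant for, the coarse part of the
    function on region b - 1, its increment over region b - 2 once cleaned up,
    and the sum over the earlier regions.  All these are nonnegative because f
    is first made increasing by adding C x with C large; the final layer
    subtracts that term. *)

Set Implicit Arguments.
Unset Strict Implicit.
Unset Printing Implicit Defensive.

Import Order.TTheory GRing.Theory Num.Theory.
Local Open Scope ring_scope.

(** * Piecewise affine functions *)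

Lemma relu_ge0 (R : realType) (t : R) : 0 <= relu t.
Proof. by rewrite /relu le_max lexx. Qed.

Lemma relu_id (R : realType) (t : R) : 0 <= t -> relu t = t.
Proof. by move=> t0; apply/max_idPr. Qed.

Lemma relu_eq0 (R : realType) (t : R) : t <= 0 -> relu t = 0.
Proof. by move=> t0; apply/max_idPl. Qed.

Lemma relu_le (R : realType) (t u : R) : 0 <= u -> t <= u -> relu t <= u.
Proof. by move=> u0 tu; rewrite /relu ge_max u0. Qed.

Lemma relu_incr (R : realType) (t x z : R) :
  x <= z -> 0 <= relu (z - t) - relu (x - t) <= z - x.
Proof.
move=> xz; case: (lerP t x) => tx.
  rewrite !relu_id; lra.
rewrite [relu (x - t)]relu_eq0; last lra.
have := relu_ge0 (z - t); have : relu (z - t) <= z - x by apply: relu_le; lra.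
lra.
Qed.

Lemma ramp_sum_lip (R : realType) m (c t : nat -> R) (x z : R) : x <= z ->
  `|\sum_(i < m) c i * relu (z - t i) - \sum_(i < m) c i * relu (x - t i)|
    <= (\sum_(i < m) `|c i|) * (z - x).
Proof.
move=> xz; rewrite -sumrB mulr_suml.
apply: (le_trans (ler_norm_sum _ _ _)); apply: ler_sum => i _.
rewrite -mulrBr normrM ler_wpM2l //.
by have /andP[h1 h2] := relu_incr (t i) xz; rewrite ger0_norm.
Qed.

Lemma affine_onP (R : realType) (g : R -> R) (a b : R) :
  affine_on g `[a, b] <->
  exists s c, forall x, a <= x <= b -> g x = s * x + c.
Proof. by split=> -[s [c h]]; exists s, c => x; have := h x; rewrite in_itv. Qed.

Lemma eq_affine_on (R : realType) (g h : R -> R) (a b : R) :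
  (forall x, a <= x <= b -> g x = h x) ->
  affine_on g `[a, b] -> affine_on h `[a, b].
Proof.
move=> gh /affine_onP[s [c gE]]; apply/affine_onP; exists s, c => x xab.
by rewrite -gh ?gE.
Qed.

Lemma affine_onD (R : realType) (g h : R -> R) (a b : R) :
  affine_on g `[a, b] -> affine_on h `[a, b] ->
  affine_on (fun x => g x + h x) `[a, b].
Proof.
move=> [s [c gE]] [s' [c' hE]]; exists (s + s'), (c + c') => x xab.
by rewrite gE ?hE //; ring.
Qed.

Lemma affine_onZ (R : realType) (g : R -> R) (k a b : R) :
  affine_on g `[a, b] -> affine_on (fun x => k * g x) `[a, b].
Proof.
by move=> [s [c gE]]; exists (k * s), (k * c) => x xab; rewrite gE //; ring.
Qed.

Lemma affine_on_sum (R : realType) (I : Type) (r : seq I) (P : pred I)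
    (g : I -> R -> R) (a b : R) :
  (forall i, P i -> affine_on (g i) `[a, b]) ->
  affine_on (fun x => \sum_(i <- r | P i) g i x) `[a, b].
Proof.
move=> gP; elim: r => [|i r IH].
  by exists 0, 0 => x _; rewrite big_nil; ring.
case: (boolP (P i)) => Pi.
  apply: (eq_affine_on _ (affine_onD (gP i Pi) IH)) => x _.
  by rewrite big_cons Pi.
by apply: (eq_affine_on _ IH) => x _; rewrite big_cons (negbTE Pi).
Qed.

Lemma affine_on_ramp (R : realType) (t a b : R) :
  t <= a \/ b <= t -> affine_on (fun x => relu (x - t)) `[a, b].
Proof.
case=> h; apply/affine_onP.
  by exists 1, (- t) => x xab; rewrite relu_id; lra.
by exists 0, 0 => x xab; rewrite relu_eq0; lra.
Qed.

(** With [k] the common sign at both ends, convexity keeps the sign of the affine function in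
    between, so [relu] is the identity or zero throughout. *)
Lemma affine_on_relu (R : realType) (s c k a b : R) : (k = 1 \/ k = -1) ->
  0 <= k * (s * a + c) -> 0 <= k * (s * b + c) ->
  affine_on (fun x => relu (s * x + c)) `[a, b].
Proof.
move=> k1 ha hb; apply/affine_onP.
have hx x : a <= x <= b -> 0 <= k * (s * x + c).
  move=> /andP[ax xb]; have [ba|ab] := leP b a.
    by have -> : x = a by lra.
  have -> : k * (s * x + c) = ((b - x) * (k * (s * a + c))
    + (x - a) * (k * (s * b + c))) / (b - a).
    by field; rewrite subr_eq0 gt_eqF.
  apply: divr_ge0; last by rewrite subr_ge0 ltW.
  by apply: addr_ge0; apply: mulr_ge0; rewrite // subr_ge0.
case: k1 => kE; rewrite kE in hx.
  by exists s, c => x /hx; rewrite mul1r => /relu_id.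
by exists 0, 0 => x /hx h; rewrite relu_eq0; lra.
Qed.

Lemma incr_le (R : realType) (T : nat) (t : nat -> R) :
  (forall i, (i < T)%N -> t i < t i.+1) ->
  forall i j, (i <= j <= T)%N -> t i <= t j.
Proof.
move=> tI i j /andP[]; elim: j => [|j IH]; first by case: i.
rewrite leq_eqVlt => /predU1P[-> //|ij] jT.
exact: le_trans (IH ij (ltnW jT)) (ltW (tI _ jT)).
Qed.

Lemma pl_coefs (R : realType) (T : nat) (t : nat -> R) (g : R -> R) :
  (forall i, (i < T)%N -> t i < t i.+1) ->
  (forall i, (i < T)%N -> affine_on g `[t i, t i.+1]) ->
  exists e : nat -> R, forall x, t 0%N <= x <= t T ->
    g x = g (t 0%N) + \sum_(i < T) e i * relu (x - t i).
Proof.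
elim: T => [|T IH] tI gA.
  exists (fun=> 0) => x; rewrite big_ord0 addr0 => /andP[h1 h2].
  by congr g; apply/eqP; rewrite eq_le h1 h2.
have [e eE] := IH (fun i iT => tI i (ltnW iT)) (fun i iT => gA i (ltnW iT)).
have /affine_onP[s [c gE]] := gA T (ltnSn T).
have le_t := incr_le tI.
(* Right of [t T] the old ramps have total slope [\sum e i], so the new coefficient is the change of
   slope there. *)
exists (fun i => if (i < T)%N then e i else s - \sum_(i < T) e i) => x /andP[x0 xT].
rewrite big_ord_recr /= ltnn.
under eq_bigr => i _ do rewrite ltn_ord.
have [xl|xl] := leP x (t T).
  by rewrite eE ?x0 // [relu (x - t T)]relu_eq0 ?mulr0 ?addr0 // subr_le0.
have gT : g (t T) = g (t 0%N) + \sum_(i < T) e i * relu (t T - t i).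
  by apply: eE; rewrite lexx le_t //= leqnSn.
have -> : \sum_(i < T) e i * relu (x - t i) =
   \sum_(i < T) e i * relu (t T - t i) + (\sum_(i < T) e i) * (x - t T).
  rewrite mulr_suml -big_split /=; apply: eq_bigr => i _.
  have ti : t i <= t T by apply: le_t; rewrite leqnSn andbT ltnW.
  rewrite !relu_id; [ring|lra|lra].
rewrite relu_id; last lra.
have := gE (t T); have := gE x; rewrite (ltW xl) xT lexx /= (ltW (tI _ _)) //.
move=> /(_ isT) -> /(_ isT); rewrite gT => h.
have -> : c = s * t T + c - s * t T by ring.
by rewrite -h; ring.
Qed.

Lemma affine_onS (R : realType) (g : R -> R) (a b a' b' : R) :
  a <= a' -> b' <= b -> affine_on g `[a, b] -> affine_on g `[a', b'].
Proof.
move=> aa bb /affine_onP[s [c gE]]; apply/affine_onP; exists s, c => x xab.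
by apply: gE; lra.
Qed.

(* [S] lists, in increasing order, pairwise non-adjacent intervals
   [[t i, t i.+1]] lying strictly between the knots [m] and [T]. *)
Fixpoint spaced (m : nat) (S : seq nat) (T : nat) : bool :=
  if S is i :: S' then (m < i)%N && spaced i.+1 S' T else (m < T)%N.

Lemma spaced_lt m S T : spaced m S T -> (m < T)%N.
Proof.
elim: S m => //= i S IH m /andP[mi /IH]; exact/ltn_trans/ltnW.
Qed.

Lemma spaced_mem m S T j : spaced m S T -> j \in S -> (m < j < T)%N.
Proof.
elim: S m => //= i S IH m /andP[mi sp]; rewrite in_cons => /predU1P[->|jS].
  by rewrite mi; move: (spaced_lt sp); lia.
by have := IH _ sp jS; lia.
Qed.

(* [u] crosses zero in the interval [i] of [S] exactly at [z i], with slope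
   [a i] up to an alternating sign, and keeps its sign in between; going up or
   down, the kink of [relu u] at [z i] is [a i].  The sign condition on [v]
   makes the last crossing go down. *)
Lemma zigzag (R : realType) (T : nat) (t z a : nat -> R) (kappa : R) :
  (forall i, (i < T)%N -> t i < t i.+1) -> kappa <= 0 ->
  forall (S : seq nat) (m : nat) (v : R), spaced m S T ->
  {in S, forall i, 0 < a i /\ t i <= z i <= t i.+1} ->
  0 <= (-1) ^+ (size S).+1 * v ->
  exists (c0 : R) (r : seq (nat * R)),
    let u x := v + c0 * relu (x - t m) + \sum_(p <- r) p.2 * relu (x - t p.1) in
    [/\ size r = (size S).*2.+1, all (fun p => (m < p.1 <= T)%N) r,
        forall k, (m <= k < T)%N ->
          affine_on (fun x => relu (u x) - \sum_(i <- S) a i * relu (x - z i))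
            `[t k, t k.+1]
      & forall x, t T <= x -> u x = kappa + (x - t T)].
Proof.
move=> tI k0; have le_t := incr_le tI.
elim=> [|i S IH] m v /=.
  move=> mT _; rewrite expr1 mulN1r => v0.
  have tmT : t m < t T.
    by apply: lt_le_trans (tI _ mT) _; apply: le_t; rewrite mT leqnn.
  have [sl slE] : exists sl, sl * (t T - t m) = kappa - v.
    exists ((kappa - v) / (t T - t m)).
    by rewrite divfK // subr_eq0 gt_eqF.
  (* With no crossing left, one segment runs from [v] to [kappa], both nonpositive; the knot [T]
     then turns the slope to 1. *)
  exists sl, [:: (T, 1 - sl)]; split=> //=; first by rewrite mT leqnn.
    move=> k /andP[mk kT].
    have ? : t m <= t k by apply: le_t; rewrite mk ltnW.
    have ? : t k.+1 <= t T by apply: le_t; rewrite kT leqnn.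
    apply: (@affine_onS _ _ (t m) (t T)) => //.
    have : affine_on (fun x => relu (sl * x + (v - sl * t m))) `[t m, t T].
      apply: (@affine_on_relu _ _ _ (-1)); first by right.
        have -> : sl * t m + (v - sl * t m) = v by ring.
        lra.
      have -> : sl * t T + (v - sl * t m) = kappa by rewrite -[kappa](subrK v) -slE; ring.
      by lra.
    apply: eq_affine_on => x /andP[x1 x2].
    rewrite big_nil big_seq1 subr0 /= [relu (x - t m)]relu_id; last lra.
    by rewrite [relu (x - t T)]relu_eq0; [congr relu; ring|lra].
  move=> x xT; rewrite big_seq1 /= !relu_id; [|lra|lra].
  by rewrite -[kappa](subrK v) -slE; ring.
move=> /andP[mi sp] aS; rewrite exprS exprS mulrA mulN1r opprK mul1r.
set s := (-1) ^+ size S => sv.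
have s1 : s = 1 \/ s = -1.
  by rewrite /s -signr_odd; case: odd; [right|left].
have ss : s * s = 1 by case: s1 => ->; ring.
have iT := spaced_lt sp.
have [ai /andP[zi1 zi2]] := aS i (mem_head _ _).
have tii := tI i (ltnW iT).
have tmi : t m < t i.
  have miT : (m < T)%N by lia.
  by apply: lt_le_trans (tI _ miT) _; apply: le_t; lia.
(* The tail starts at [t i.+1] from the value there of the crossing line
   [- (s * a i) * (x - z i)]. *)
have [||c0 [r [rs rT uA uE]]] := IH i.+1 (s * a i * (z i - t i.+1)) sp.
- by move=> j jS; apply: aS; rewrite in_cons jS orbT.
- rewrite exprS -/s.
  have -> : -1 * s * (s * a i * (z i - t i.+1)) =
    s * s * (a i * (t i.+1 - z i)) by ring.
  by rewrite ss mul1r mulr_ge0 //; lra.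
have [s1' s1E] : exists s', s' * (t i - t m) = s * a i * (z i - t i) - v.
  exists ((s * a i * (z i - t i) - v) / (t i - t m)).
  by rewrite divfK // subr_eq0 gt_eqF.
(* The slopes are [s1'], then [- (s * a i)], then [c0]; the two new coefficients are the jumps
   between them. *)
exists s1', ((i, - (s * a i) - s1') :: (i.+1, c0 + s * a i) :: r).
pose u x := s * a i * (z i - t i.+1) + c0 * relu (x - t i.+1) +
  \sum_(p <- r) p.2 * relu (x - t p.1).
have {}uA k : (i < k < T)%N -> affine_on (fun x => relu (u x) -
  \sum_(j <- S) a j * relu (x - z j)) `[t k, t k.+1] by exact: uA.
have {}uE x : t T <= x -> u x = kappa + (x - t T) by exact: uE.
pose u' x := v + s1' * relu (x - t m) +
  \sum_(p <- (i, - (s * a i) - s1') :: (i.+1, c0 + s * a i) :: r)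
    p.2 * relu (x - t p.1).
have r_eq0 x : x <= t i.+1 -> \sum_(p <- r) p.2 * relu (x - t p.1) = 0.
  move=> xi; rewrite big_seq big1 // => p /(allP rT) /andP[pi pT].
  rewrite relu_eq0 ?mulr0 // subr_le0 (le_trans xi) //.
  by apply: le_t; rewrite pT andbT ltnW.
have u'l x : t m <= x <= t i -> u' x = s1' * x + (v - s1' * t m).
  move=> /andP[x1 x2]; rewrite /u' !big_cons /= [relu (x - t m)]relu_id; last lra.
  rewrite [relu (x - t i)]relu_eq0 ?[relu (x - t i.+1)]relu_eq0; [|lra|lra].
  by rewrite r_eq0; [ring|lra].
have u'm x : t i <= x <= t i.+1 -> u' x = - (s * a i) * (x - z i).
  move=> /andP[x1 x2]; rewrite /u' !big_cons /= [relu (x - t m)]relu_id; last lra.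
  rewrite [relu (x - t i)]relu_id; last lra.
  rewrite [relu (x - t i.+1)]relu_eq0 ?r_eq0; [|lra|lra].
  have -> : v = s * a i * (z i - t i) - s1' * (t i - t m) by rewrite s1E; ring.
  ring.
have u'r x : t i.+1 <= x -> u' x = u x.
  move=> x1; rewrite /u' /u !big_cons /= !(@relu_id _ (x - t _)); [|lra|lra|lra].
  have -> : v = s * a i * (z i - t i) - s1' * (t i - t m) by rewrite s1E; ring.
  ring.
have zS k : (k <= i)%N -> affine_on
    (fun x => - \sum_(j <- S) a j * relu (x - z j)) `[t k, t k.+1].
  move=> ki; apply: (@eq_affine_on _
    (fun x => \sum_(j <- S | j \in S) (- a j) * relu (x - z j))).
    by move=> x _; rewrite -big_seq -sumrN; apply: eq_bigr => j _; rewrite mulNr.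
  apply: affine_on_sum => j jS; apply/affine_onZ/affine_on_ramp; right.
  have /andP[ij jT] := spaced_mem sp jS.
  have [|_ /andP[zj _]] := aS j; first by rewrite in_cons jS orbT.
  apply: le_trans zj; apply: le_t; clear - ki ij jT; lia.
split.
- by rewrite /= rs.
- rewrite /=; apply/and3P; split; [clear - mi iT; lia|clear - mi iT; lia|].
  by apply: sub_all rT => p /andP[h1 h2]; clear - mi h1 h2; lia.
- move=> k /andP[mk kT]; have [ki|ki|ki] := ltngtP k i.
  + have tk1 : t m <= t k by apply: le_t; rewrite mk ltnW.
    have tk2 : t k.+1 <= t i by apply: le_t; rewrite ki ltnW // ltnW.
    have h1 : affine_on (fun x => relu (s1' * x + (v - s1' * t m))) `[t k, t k.+1].
      apply: (affine_onS tk1 tk2); apply: (affine_on_relu s1).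
        by have -> : s1' * t m + (v - s1' * t m) = v by ring.
      have -> : s1' * t i + (v - s1' * t m) = s1' * (t i - t m) + v by ring.
      have -> : s * (s1' * (t i - t m) + v) = s * s * (a i * (z i - t i)).
        by rewrite s1E; ring.
      by rewrite ss mul1r mulr_ge0 //; lra.
    have h2 : affine_on (fun x => - a i * relu (x - z i)) `[t k, t k.+1].
      by apply/affine_onZ/affine_on_ramp; right; lra.
    apply: (eq_affine_on _ (affine_onD h1 (affine_onD h2 (zS k (ltnW ki))))) => x xk.
    by rewrite /= -/(u' x) u'l ?big_cons; [ring|lra].
  + have h : affine_on (fun x => relu (u x) - \sum_(j <- S) a j * relu (x - z j))
      `[t k, t k.+1] by apply: uA; rewrite ki.
    have h2 : affine_on (fun x => - a i * relu (x - z i)) `[t k, t k.+1].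
      apply/affine_onZ/affine_on_ramp; left; apply: (le_trans zi2).
      by apply: le_t; rewrite ki ltnW.
    apply: (eq_affine_on _ (affine_onD h h2)) => x /andP[x1 x2].
    rewrite /= -/(u' x) u'r ?big_cons; first ring.
    by apply: le_trans x1; apply: le_t; rewrite ki ltnW.
  + rewrite ki.
    (* For [s = -1] the zigzag goes up and [relu] yields the kink itself; for [s = 1] it goes down,
       and [relu (- w) = relu w - w] yields the same kink up to an affine term. *)
    have h : affine_on (fun x => relu (- (s * a i) * (x - z i))
        - a i * relu (x - z i)) `[t i, t i.+1].
      apply/affine_onP; case: s1 => ->; [exists (- a i), (a i * z i)|exists 0, 0];
      move=> x _; have [xz|xz] := leP x (z i).
      - rewrite relu_id ?[relu (x - z i)]relu_eq0; [ring|lra|].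
        by rewrite mulNr mul1r -mulrN mulr_ge0 //; lra.
      - rewrite relu_eq0 ?[relu (x - z i)]relu_id; [ring|lra|].
        by rewrite mulNr mul1r oppr_le0 mulr_ge0 //; lra.
      - rewrite relu_eq0 ?[relu (x - z i)]relu_eq0; [ring|lra|].
        by rewrite mulN1r opprK mulr_ge0_le0 //; lra.
      - rewrite !relu_id; [ring|lra|].
        by rewrite mulN1r opprK mulr_ge0 //; lra.
    apply: (eq_affine_on _ (affine_onD h (zS i (leqnn i)))) => x xi.
    by rewrite /= -/(u' x) u'm ?big_cons //; ring.
- move=> x xT; rewrite -/(u' x) u'r ?uE //; apply: le_trans xT.
  by apply: le_t; clear - iT; lia.
Qed.

(** * Coding one region in two consecutive layers *)

(** Indices of equal parity are never consecutive. The second alternative on [m] is the state right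
    after an index was kept: [s] has the wrong parity and gets skipped. *)
Lemma spaced_filter (par : bool) (P : pred nat) (T l s m : nat) :
  (m < s)%N || (m == s) && (odd s != par) -> (s + l < T)%N ->
  spaced m [seq i <- iota s l | (odd i == par) && P i] T.
Proof.
elim: l s m => [|l IH] s m /= ms slT; first lia.
have [os|os] /= := eqVneq (odd s) par; last by apply: IH; [lia|lia].
rewrite os eqxx andbF orbF in ms.
case: ifP => _ /=; last by apply: IH; lia.
rewrite ms; apply: IH; last by lia.
by rewrite eqxx ltnn /= -os; case: (odd s).
Qed.

Lemma big_mul_ord (V : Type) (idx : V) (op : Monoid.law idx) (N M : nat)
    (F : nat -> V) :
  \big[op/idx]_(i < N * M) F i =
  \big[op/idx]_(i < N) \big[op/idx]_(j < M) F (i * M + j)%N.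
Proof.
elim: N => [|N IH]; first by rewrite !big_ord0.
by rewrite big_ord_recr /= -IH mulSn addnC big_split_ord.
Qed.

(** Turns a list of kinks into a row of weights. Coefficients at a repeated knot add up, so the
    length only bounds the number of nonzero weights. *)
Lemma sparse_coefs (R : realType) (r : seq (nat * R)) (n : nat) :
  all (fun p => (p.1 < n)%N) r ->
  exists c : nat -> R,
    (forall g : nat -> R, \sum_(i < n) c i * g i = \sum_(p <- r) p.2 * g p.1) /\
    (\sum_(i < n) (c i != 0%R) <= size r)%N.
Proof.
elim: r => [|[j a] r IH] /=.
  exists (fun=> 0); split=> [g|]; first by rewrite big_nil big1 // => i _; rewrite mul0r.
  by rewrite big1 // => i _; rewrite eqxx.
move=> /andP[jn /IH[c [cE cn]]].
exists (fun i => c i + (if i == j then a else 0)); split.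
  move=> g; rewrite big_cons -cE /=; under eq_bigr => i _ do rewrite mulrDl.
  rewrite big_split /= addrC; congr (_ + _).
  rewrite (bigD1 (Ordinal jn)) //= eqxx big1 ?addr0 // => i ij.
  by rewrite ifN ?mul0r //; apply: contraNneq ij => ij; apply/eqP/val_inj.
apply: (@leq_trans (\sum_(i < n) ((c i != 0%R) + (i == Ordinal jn)))).
  apply: leq_sum => i _; have -> : (i == Ordinal jn) = (i == j :> nat) by [].
  case: (eqVneq (i : nat) j) => _; last by rewrite addr0 addn0.
  by case: (_ != 0); rewrite ?addn1.
rewrite big_split /= -addn1 leq_add //.
by rewrite (bigD1 (Ordinal jn)) //= eqxx big1 // => i /negbTE ->.
Qed.

(* Pads the data points of a region with dummy ones, so that all coarse
   intervals can be treated as full. *)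
Lemma refine_below (R : realType) (q : nat -> R) (k : nat) (B : R) : (0 < k)%N ->
  (forall i, (i < k.-1)%N -> q i < q i.+1) -> q k.-1 < B ->
  exists p : nat -> R, [/\ forall i, (i < k)%N -> p i = q i,
    {homo p : i j / (i < j)%N >-> i < j} & forall i, p i < B].
Proof.
case: k => // k _ /= qI qB.
(* The dummies increase towards [B], starting from the last genuine point [q k], the value of the
   formula at [i = k]. *)
exists (fun i => if (i < k.+1)%N then q i else B - (B - q k) / (i - k).+1%:R).
have d0 (i : nat) : 0 < i.+1%:R :> R by rewrite ltr0n.
split.
- by move=> i ->.
- apply: homo_ltn; first by move=> ? ? ?; apply: lt_trans.
  move=> i; case: (ltngtP i k) => ik.
  + by rewrite !ifT; [apply: qI|lia|lia].
  + rewrite !ifF; [|lia|lia].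
    rewrite ltrD2l ltrN2 ltr_pM2l ?subr_gt0 // ltf_pV2 ?posrE ?ltr_nat //; lia.
  + rewrite ik ltnS leqnn ifF; last lia.
    rewrite ltrBrDl -ltrBrDr gtr_pMr ?subr_gt0 // invf_lt1 ?ltr1n //; lia.
- move=> i; case: ifP => ik.
    apply: le_lt_trans qB.
    have le_q : forall i j, (i <= j <= k)%N -> q i <= q j by apply: incr_le.
    by apply: le_q; lia.
  by rewrite ltrBlDr ltrDl divr_gt0 // subr_gt0.
Qed.

(* Neuron [j = 4 j' + 2 s + p] serves the [j']-th fine point of the coarse
   intervals of parity [p], if the kink there is positive ([s = 0]) or negative
   ([s = 1]).  The intervals are numbered from 1. *)
Definition crossings (R : realType) (amp : nat -> R) (N M j : nat) : seq nat :=
  [seq i <- iota 1 N | (odd i == odd j) && ((j < M * 4)%N &&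
    (if odd j./2 then amp (i.-1 * M + j %/ 4).+1 < 0
     else 0 < amp (i.-1 * M + j %/ 4).+1))].

(** Each index with a nonzero kink belongs to exactly one neuron. A general [op] lets this serve
    both for adding up the kinks and for counting them. *)
Lemma big_crossings (V : Type) (idx : V) (op : Monoid.com_law idx)
    (R : realType) (amp : nat -> R) (N M m : nat) (w : bool -> nat -> V) :
  (M * 4 <= m)%N ->
  \big[op/idx]_(j < m) \big[op/idx]_(i <- crossings amp N M j)
    w (odd j./2) (i.-1 * M + j %/ 4).+1 =
  \big[op/idx]_(n < N * M)
    (if 0 < amp n.+1 then w false n.+1
     else if amp n.+1 < 0 then w true n.+1 else idx).
Proof.
move=> Mm.
pose F j := \big[op/idx]_(i <- crossings amp N M j)
    w (odd j./2) (i.-1 * M + j %/ 4).+1.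
have F0 j : (M * 4 <= j)%N -> F j = idx.
  move=> Mj; rewrite /F /crossings big_filter big_pred0 // => i.
  by rewrite [(j < _)%N]ltnNge Mj andbF.
transitivity (\big[op/idx]_(j < M * 4) F j).
  rewrite (big_ord_widen _ F Mm) [RHS]big_mkcond /=; apply: eq_bigr => j _.
  by case: ltnP => // /F0.
rewrite big_mul_ord (big_mul_ord _ N M (fun n => if 0 < amp n.+1 then w false n.+1
     else if amp n.+1 < 0 then w true n.+1 else idx)) [RHS]exchange_big /=.
apply: eq_bigr => j _.
have FE r : (r < 4)%N -> F (j * 4 + r)%N = \big[op/idx]_(i < N)
   if (odd i.+1 == odd r) && (if odd r./2 then amp (i * M + j).+1 < 0
     else 0 < amp (i * M + j).+1)
   then w (odd r./2) (i * M + j).+1 else idx.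
  move=> r4; rewrite /F /crossings big_filter.
  have -> : ((j * 4 + r) %/ 4 = j)%N by rewrite divnMDl // divn_small // addn0.
  have -> : odd (j * 4 + r) = odd r by rewrite oddD oddM andbF.
  have -> : odd (j * 4 + r)./2 = odd r./2.
    have -> : (j * 4 + r)./2 = (j.*2 + r./2)%N by lia.
    by rewrite oddD odd_double.
  have -> : (j * 4 + r < M * 4)%N by have := ltn_ord j; lia.
  rewrite big_mkcond /=.
  have -> : iota 1 N = index_iota 1 N.+1 by rewrite /index_iota subn1.
  by rewrite big_add1 big_mkord.
have FE0 := FE 0%N isT; rewrite addn0 in FE0.
rewrite !big_ord_recl big_ord0 ?addn0 /= ?addn0 FE0 !FE // Monoid.mulm1.
rewrite -!(@big_split _ _ op) /=.
apply: eq_bigr => i _.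
by case: (odd i) => /=; case: (ltrgtP 0 (amp (i * M + j).+1)) => _;
  rewrite /= ?Monoid.mulm1 ?Monoid.mul1m.
Qed.

(* [t] are the coarse ramps of the first of the two layers.  Those of the next
   layer, [t'], are prescribed by the following region: right of [B] the neuron
   [j] of the second layer already has to be the ramp [x - t' j]. *)
Definition codable (R : realType) (f : R -> R) (A B : R) (m m' k : nat) : Prop :=
  exists t : nat -> R, (forall i, A <= t i) /\
  forall t' : nat -> R, (forall j, B <= t' j) ->
  exists (c : nat -> nat -> R) (beta sigma e : nat -> R),
  let U j x := beta j + \sum_(i < m) c j i * relu (x - t i) in
  [/\ forall j, beta j <= 0,
      forall j x, B <= x -> U j x = x - t' j,
      forall x, A <= x <= B -> \sum_(i < m) e i * relu (x - t i) =
        f x - f A + \sum_(j < m') sigma j * relu (U j x)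
    & (\sum_(j < m') \sum_(i < m) (c j i != 0%R) <= 2 * k + 2 * m')%N].

(** Covers a region reduced to a point, which occurs when its capacity is zero or the data are
    exhausted. *)
Lemma codable_pt (R : realType) (f : R -> R) (A : R) (m m' : nat) :
  (0 < m)%N -> codable f A A m m' 0.
Proof.
case: m => // m _; exists (fun=> A); split=> // t' tA.
(* Here [U j x = relu (x - A) - (t' j - A)]: one weight and a nonpositive bias give the ramp
   required right of [A]. *)
exists (fun _ i => (i == 0%N)%:R), (fun j => A - t' j), (fun=> 0), (fun=> 0).
have UE (x : R) :
    \sum_(i < m.+1) ((i : nat) == 0%N)%:R * relu (x - A) = relu (x - A).
  by rewrite big_ord_recl /= mul1r big1 ?addr0 // => i _; rewrite mul0r.
split=> [j|j x Ax|x xA|] /=.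
- by rewrite subr_le0.
- by rewrite UE relu_id; lra.
- have -> : x = A by lra.
  rewrite big1 => [|i _]; last by rewrite mul0r.
  by rewrite big1 => [|i _]; rewrite ?mul0r // subrr addr0.
- rewrite muln0 add0n mul2n -addnn -[leqRHS]/(m' + m')%N.
  apply: (@leq_trans (\sum_(j < m') 1)); last by rewrite sum1_card card_ord leq_addl.
  apply: leq_sum => j _.
  rewrite big_ord_recl /= big1 ?addn0 ?oner_eq0 // => i _.
  by rewrite eqxx.
Qed.

(** Once the zigzags cancel the fine kinks, what remains of [f] bends only at coarse knots, so the
    ramps of the first layer represent it. A zigzag with [s] crossings costs at most [2 * s + 2]
    weights, and there are at most [k] crossings in all. *)
Lemma codable_interval (R : realType) (f : R -> R) (q : nat -> R)
    (N M m m' k : nat) :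
  (0 < k <= N * M)%N -> (N.+2 < m)%N -> (M * 4 <= m')%N ->
  (forall i, (i < k)%N -> q i < q i.+1) ->
  (forall i, (i < k)%N -> affine_on f `[q i, q i.+1]) ->
  codable f (q 0%N) (q k) m m' k.
Proof.
move=> /andP[k0 kNM] Nm Mm qI qA.
have qlast : q k.-1 < q k by rewrite -[in ltRHS](prednK k0) qI // prednK.
have [p [pq pI pB]] : exists p : nat -> R, [/\ forall i, (i < k)%N -> p i = q i,
    {homo p : i j / (i < j)%N >-> i < j} & forall i, p i < q k].
  by apply: refine_below => // i ik; apply: qI; lia.
have p_le i j : (i <= j)%N -> p i <= p j.
  by rewrite leq_eqVlt => /predU1P[-> //|/pI/ltW].
have M0 : (0 < M)%N by case: (M) kNM => //; lia.
(* The coarse intervals [1..N] hold [M] fine points each; one more interval at either end gives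
   every zigzag room to leave 0 and to reach [kappa]. *)
pose t i := if i == 0%N then q 0%N else
  if (i <= N.+1)%N then p (i.-1 * M).+1 else q k.
have p0 : p 0%N = q 0%N by rewrite pq.
pose T := N.+2.
have tI i : (i < T)%N -> t i < t i.+1.
  rewrite /T /t; case: i => [|i] iT /=; first by rewrite -p0 pI.
  rewrite ifT; last lia.
  by case: ifP => _ //; apply: pI; rewrite ltnS mulSn; lia.
have le_t := incr_le tI.
have tT : t T = q k by rewrite /t ifF // ltnn.
have tE i : (0 < i <= N.+1)%N -> t i = p (i.-1 * M).+1.
  by rewrite /t => /andP[i0 ->]; case: eqP i0 => // ->.
have t_ge i : q 0%N <= t i.
  rewrite /t; case: eqP => // _; case: ifP => _; first by rewrite -p0 p_le.
  by rewrite -p0 ltW.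
exists t; split=> // t' t'B.
have [am amE] := pl_coefs qI qA.
(* Dummy points get amplitude 0, hence no crossing. *)
pose amp n := if (n < k)%N then am n else 0.
pose a j i := `|amp (i.-1 * M + j %/ 4).+1|.
pose z j i := p (i.-1 * M + j %/ 4).+1.
pose S j := crossings amp N M j.
(* Opposite to the sign of the kinks served by [j], since the neurons added to [f] must cancel
   them. *)
pose sigma j : R := if odd j./2 then 1 else - 1.
have cP j : exists c : nat -> R,
  [/\ (\sum_(i < m) (c i != 0%R) <= (size (S j)).*2.+2)%N,
    forall x, q k <= x -> \sum_(i < m) c i * relu (x - t i) = x - t' j &
    forall i, (i < T)%N -> affine_on (fun x =>
      relu (\sum_(i < m) c i * relu (x - t i)) -
      \sum_(i <- S j) a j i * relu (x - z j i)) `[t i, t i.+1]].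
  have sp : spaced 0 (S j) T by apply: spaced_filter.
  have aS : {in S j, forall i, 0 < a j i /\ t i <= z j i <= t i.+1}.
    move=> i; rewrite mem_filter mem_iota => /andP[/andP[_ /andP[jM ai]] iN].
    split.
      by move: ai; case: ifP => _; rewrite /a normr_gt0 neq_lt => ->; rewrite ?orbT.
    have jM' : (j %/ 4 < M)%N by rewrite ltn_divLR.
    rewrite !tE; [|lia|lia]; rewrite /z !p_le //; last by rewrite ltnS leq_addr.
    by rewrite ltnS -[i in leqRHS](@prednK i) ?mulSn; lia.
  (* This [kappa] makes the zigzag continue as [x - t' j] right of [q k]; the start value 0 meets
     either sign condition. *)
  have [//||c0 [r [rs rT uA uE]]] := zigzag (z := z j) (a := a j)
    (kappa := q k - t' j) (v := 0) tI _ sp aS.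
  - by rewrite subr_le0.
  - by rewrite mulr0.
  have [|c [cE cn]] := @sparse_coefs R ((0%N, c0) :: r) m.
    rewrite /=; apply/andP; split; first lia.
    by apply: sub_all rT => i /andP[_ iT]; rewrite /T in iT; lia.
  have cE' x : \sum_(i < m) c i * relu (x - t i) =
      0 + c0 * relu (x - t 0%N) + \sum_(p <- r) p.2 * relu (x - t p.1).
    by rewrite (cE (fun i => relu (x - t i))) big_cons add0r.
  exists c; split.
  - by apply: leq_trans cn _; rewrite /= rs.
  - by move=> x xq; rewrite cE' uE tT //; ring.
  - move=> i iT; apply: eq_affine_on (uA i iT) => x _.
    by rewrite cE'.
have {cP} [c cP] := choice cP.
pose U j x := \sum_(i < m) c j i * relu (x - t i).
have SE (G : nat -> R) : \sum_(j < m') sigma j *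
    (\sum_(i <- S j) a j i * G (i.-1 * M + j %/ 4).+1) =
    - \sum_(n < k.-1) am n.+1 * G n.+1.
  have h := big_crossings +%R amp N
    (fun s n => (if s then 1 else -1) * (`|amp n| * G n)) Mm.
  rewrite -/S in h.
  transitivity (\sum_(n < N * M) - (amp n.+1 * G n.+1)).
    transitivity (\sum_(n < N * M) (if 0 < amp n.+1
      then (if false then 1 else -1) * (`|amp n.+1| * G n.+1)
      else if amp n.+1 < 0 then (if true then 1 else -1) * (`|amp n.+1| * G n.+1)
      else 0)).
      by rewrite -h; apply: eq_bigr => j _; rewrite mulr_sumr.
    apply: eq_bigr => n _; case: ltrgtP => [ap|an|<-].
    - by rewrite gtr0_norm // mulN1r.
    - by rewrite ltr0_norm // mul1r mulNr.
    - by rewrite mul0r oppr0.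
  rewrite sumrN; congr (- _).
  have kl : (k.-1 <= N * M)%N by lia.
  rewrite (big_ord_widen _ (fun n => am n.+1 * G n.+1) kl) [RHS]big_mkcond /=.
  apply: eq_bigr => n _; rewrite /amp -ltn_predRL.
  by case: ifP; rewrite ?mul0r.
pose H x := f x - f (q 0%N) + \sum_(j < m') sigma j * relu (U j x).
have HA i : (i < T)%N -> affine_on H `[t i, t i.+1].
  move=> iT.
  have h1 : affine_on (fun x => \sum_(j < m') sigma j * (relu (U j x) -
      \sum_(i <- S j) a j i * relu (x - z j i))) `[t i, t i.+1].
    by apply: affine_on_sum => j _; apply: affine_onZ; case: (cP j) => _ _; apply.
  have h2 : affine_on (fun x => am 0%N * relu (x - q 0%N)) `[t i, t i.+1].
    by apply/affine_onZ/affine_on_ramp; left.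
  apply: eq_affine_on (affine_onD h1 h2) => x /andP[x1 x2].
  have xq : q 0%N <= x <= q k.
    rewrite (le_trans _ x1) //= (le_trans x2) // -tT; apply: le_t; lia.
  rewrite /H amE //.
  under eq_bigr => j _ do rewrite mulrBr.
  rewrite sumrB (SE (fun n => relu (x - p n))).
  have -> : \sum_(i < k) am i * relu (x - q i) = am 0%N * relu (x - q 0%N) +
      \sum_(n < k.-1) am n.+1 * relu (x - p n.+1).
    case: (k) k0 pq => // k' _ pq'; rewrite big_ord_recl /=; congr (_ + _).
    by apply: eq_bigr => n _; rewrite /bump /= pq' // ltnS.
  ring.
have [e eE] := pl_coefs tI HA.
exists c, (fun=> 0), sigma, (fun i => if (i < T)%N then e i else 0).
split=> [//|j x xq|x xq|].
- by rewrite add0r; case: (cP j) => _ ->.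
- have -> : f x - f (q 0%N) + \sum_(j < m') sigma j * relu (0 + U j x) = H x.
    by rewrite /H; congr (_ + _); apply: eq_bigr => j _; rewrite add0r.
  have Tm : (T <= m)%N by rewrite /T; lia.
  rewrite eE; last by rewrite tT.
  have -> : H (t 0%N) = 0.
    rewrite /H subrr add0r big1 // => j _; rewrite /U big1 ?relu_eq0 ?mulr0 // => i _.
    by rewrite relu_eq0 ?mulr0 // subr_le0.
  rewrite add0r (big_ord_widen _ (fun i => e i * relu (x - t i)) Tm) big_mkcond /=.
  by rewrite [RHS]big_mkcond /=; apply: eq_bigr => i _; case: ifP; rewrite ?mul0r.
- apply: (@leq_trans (\sum_(j < m') ((size (S j)).*2 + 2))).
    by apply: leq_sum => j _; rewrite addn2; case: (cP j).
  rewrite big_split /= sum_nat_const card_ord mulnC leq_add2r.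
  have -> : (\sum_(j < m') (size (S j)).*2 =
      2 * \sum_(j < m') \sum_(i <- S j) 1)%N.
    by rewrite big_distrr /=; apply: eq_bigr => j _; rewrite sum1_size mul2n.
  rewrite leq_mul2l /= (big_crossings _ amp N (fun _ _ => 1%N) Mm).
  apply: (@leq_trans (\sum_(n < N * M | (n < k)%N) 1)).
    rewrite [leqRHS]big_mkcond; apply: leq_sum => n _ /=; rewrite /amp.
    case: (ltnP n.+1 k) => [nk|_]; last by rewrite ltxx.
    by rewrite (ltnW nk); case: ifP => // _; case: ifP.
  rewrite -(big_ord_widen _ (fun=> 1%N) kNM) sum1_card card_ord //.
Qed.

(** * The network *)

(* Invariant of layer b, with [A = A_b] and g z = f z + C * z: left of [A],
   [r] and the channels [clean] and [acc] still sum to the telescoping rest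
   g A - g x; right of [A], [r] is garbage, but of at most linear growth, so
   that a multiple of (x - A)_+ removes it. *)
Definition layer_state (R : realType) (f : R -> R) (A : R) (m : nat)
    (t : nat -> R) (C d : R) (sigma : nat -> R) (Lam x corr clean acc : R)
    (v : nat -> R) : Prop :=
  let r := d - corr + \sum_(k < m) sigma k * v k in
  [/\ A <= x -> forall k, (k < m)%N -> v k = relu (x - t k),
      x <= A -> forall k, (k < m)%N -> 0 <= v k <= Lam * (A - x),
      x <= A -> 0 <= r /\ r + (clean + acc) = f A + C * A - f x - C * x,
      A <= x -> r <= Lam * (x - A) /\ clean + acc = 0
    & 0 <= clean /\ 0 <= acc].

Lemma sum_le_bound (R : realType) m (c v : nat -> R) (b : R) : 0 <= b ->
  (forall k, (k < m)%N -> 0 <= v k <= b) ->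
  `|\sum_(k < m) c k * v k| <= (\sum_(k < m) `|c k|) * b.
Proof.
move=> b0 vb; rewrite mulr_suml.
apply: (le_trans (ler_norm_sum _ _ _)); apply: ler_sum => k _.
have /andP[h1 h2] := vb k (ltn_ord k).
by rewrite normrM ler_wpM2l // ger0_norm.
Qed.

(** Left of [A], [K * neg] outweighs the sums over [v], so the new [corr] and [v] vanish; between
    [A] and [B] the coding identity gives the remainder; right of [B] only linear growth is needed.
    [Lf <= C] keeps the remainder nonnegative, [Se <= C] the argument of the new [corr] right of
    [A]. *)
Lemma layer_state_step (R : realType) (f : R -> R) (Lf A B : R) (m m' : nat)
    (t t' : nat -> R) (c : nat -> nat -> R) (beta sigma' e : nat -> R)
    (C d : R) (sigma : nat -> R) (Lam x corr clean acc : R) (v : nat -> R) :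
  let Sc := \sum_(j < m') \sum_(i < m) `|c j i| in
  let Se := \sum_(i < m) `|e i| in
  let Ss := \sum_(j < m') `|sigma' j| in
  let K := Lam * (Sc + Se) in
  let U j x := beta j + \sum_(i < m) c j i * relu (x - t i) in
  let pos := relu (x - A) in let neg := relu (A - x) in
  (forall x z, x <= z -> `|f z - f x| <= Lf * (z - x)) ->
  A <= B -> (forall i, A <= t i) -> (forall j, B <= t' j) ->
  (forall j, beta j <= 0) -> (forall j x, B <= x -> U j x = x - t' j) ->
  (forall x, A <= x <= B -> \sum_(i < m) e i * relu (x - t i) =
     f x - f A + \sum_(j < m') sigma' j * relu (U j x)) ->
  Lf <= C -> Se <= C -> 0 <= Lam ->
  layer_state f A m t C d sigma Lam x corr clean acc v ->
  layer_state f B m' t' C (f B + C * B - f A - C * A) sigma' (Sc + Se + Ss) x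
    (relu (C * pos - K * neg + \sum_(i < m) e i * v i))
    (relu (d - corr + \sum_(i < m) sigma i * v i - Lam * pos))
    (relu (clean + acc))
    (fun j => relu (beta j - K * neg + \sum_(i < m) c j i * v i)).
Proof.
move=> Sc Se Ss K U pos neg fL AB tA tB b0 UB eE LC SC Lam0 [vr vl rl rr [cl0 ac0]].
have Sc0 : 0 <= Sc by apply: sumr_ge0 => j _; apply: sumr_ge0.
have Se0 : 0 <= Se by apply: sumr_ge0.
have Ss0 : 0 <= Ss by apply: sumr_ge0.
have C0 : 0 <= C by apply: le_trans SC.
have Scj j : (j < m')%N -> \sum_(i < m) `|c j i| <= Sc.
  move=> jm; rewrite /Sc (bigD1 (Ordinal jm)) //= lerDl.
  by apply: sumr_ge0 => ? _; apply: sumr_ge0.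
have fC y z : y <= z -> 0 <= f z + C * z - f y - C * y.
  move=> yz; have := fL _ _ yz; rewrite ler_norml => /andP[h _].
  have : 0 <= (C - Lf) * (z - y) by rewrite mulr_ge0 ?subr_ge0.
  by lra.
set E := fun y => \sum_(i < m) e i * relu (y - t i).
have ramp_b y i : A <= y -> 0 <= relu (y - t i) <= y - A.
  move=> Ay; rewrite relu_ge0 relu_le //; have := tA i; lra.
have U_B j : U j B = B - t' j by apply: UB.
have EB : E B = f B - f A.
  rewrite /E eE ?lexx ?AB // big1 ?addr0 // => j _.
  by rewrite U_B relu_eq0 ?mulr0 // subr_le0.
set corr' := relu (C * pos - _ + _).
set clean' := relu (_ - Lam * pos).
set v' := fun j => relu (_ + _ + _).
have v'E j : A <= x -> v' j = relu (U j x).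
  move=> Ax; rewrite /v' /neg [relu (A - x)]relu_eq0 ?subr_le0 // mulr0 subr0.
  congr (relu (_ + _)); apply: eq_bigr => i _; by rewrite vr.
have v'0 j : (j < m')%N -> x <= A -> v' j = 0.
  move=> jm xA; rewrite /v' /neg relu_eq0 //.
  rewrite relu_id ?subr_ge0 //.
  have b : 0 <= Lam * (A - x) by rewrite mulr_ge0 ?subr_ge0.
  have := sum_le_bound (c j) b (vl xA); rewrite ler_norml => /andP[_ h].
  have h2 : (\sum_(k < m) `|c j k|) * (Lam * (A - x)) <= Sc * (Lam * (A - x)).
    by rewrite ler_wpM2r // Scj.
  have h3 : 0 <= Se * (Lam * (A - x)) by rewrite mulr_ge0.
  have := b0 j; rewrite /K.
  have -> : Lam * (Sc + Se) * (A - x) =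
    Sc * (Lam * (A - x)) + Se * (Lam * (A - x)) by ring.
  lra.
have corrE : A <= x -> corr' = E x + C * (x - A).
  move=> Ax; rewrite /corr' /pos /neg [relu (A - x)]relu_eq0 ?subr_le0 //.
  rewrite [relu (x - A)]relu_id ?subr_ge0 // mulr0 subr0.
  have -> : \sum_(i < m) e i * v i = E x by apply: eq_bigr => i _; rewrite vr.
  rewrite addrC relu_id //.
  have xA0 : 0 <= x - A by rewrite subr_ge0.
  have hE : `|E x| <= Se * (x - A).
    by apply: (@sum_le_bound _ m e (fun k => relu (x - t k))) => // k _; apply: ramp_b.
  move: hE; rewrite ler_norml => /andP[h _].
  have : 0 <= (C - Se) * (x - A) by rewrite mulr_ge0 ?subr_ge0.
  by lra.
have corr0 : x <= A -> corr' = 0.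
  move=> xA; rewrite /corr' /pos /neg [relu (x - A)]relu_eq0 ?subr_le0 //.
  rewrite [relu (A - x)]relu_id ?subr_ge0 // relu_eq0 //.
  have b : 0 <= Lam * (A - x) by rewrite mulr_ge0 ?subr_ge0.
  have := sum_le_bound e b (vl xA); rewrite ler_norml -/Se => /andP[_ h].
  have h3 : 0 <= Sc * (Lam * (A - x)) by rewrite mulr_ge0.
  rewrite /K.
  have -> : Lam * (Sc + Se) * (A - x) =
    Sc * (Lam * (A - x)) + Se * (Lam * (A - x)) by ring.
  lra.
have cleanl : x <= A -> clean' + relu (clean + acc) = f A + C * A - f x - C * x.
  move=> xA; have [r0 <-] := rl xA.
  rewrite /clean' /pos [relu (x - A)]relu_eq0 ?subr_le0 // mulr0 subr0 relu_id //.
  by rewrite [relu (clean + acc)]relu_id // addr_ge0.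
have cleanr : A <= x -> clean' + relu (clean + acc) = 0.
  move=> Ax; have [r0 ->] := rr Ax.
  rewrite [relu 0]relu_eq0 // addr0 /clean' relu_eq0 //.
  by rewrite subr_le0 /pos [relu (x - A)]relu_id ?subr_ge0.
(* [Sc] bounds the slopes of [v'] left of [B], and [Se + Ss] the growth of the new [r] right of
   [B]. *)
have Lam'0 : 0 <= Sc + Se + Ss by rewrite !addr_ge0.
split=> [Bx k km|xB k km|xB|Bx|]; last by rewrite !relu_ge0.
- by rewrite v'E ?UB //; apply: le_trans Bx.
- have b : 0 <= (Sc + Se + Ss) * (B - x) by rewrite mulr_ge0 ?subr_ge0.
  have [xA|/ltW Ax] := leP x A; first by rewrite v'0 // lexx.
  rewrite v'E // relu_ge0 relu_le //.
  have := ramp_sum_lip m (c k) t xB; rewrite ler_norml => /andP[h _].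
  have h2 : (\sum_(i < m) `|c k i|) * (B - x) <= Sc * (B - x).
    by rewrite ler_wpM2r ?subr_ge0 // Scj.
  have h3 : 0 <= (Se + Ss) * (B - x) by apply: mulr_ge0; rewrite ?subr_ge0 // addr_ge0.
  have := U_B k; rewrite /U => h4; have := tB k.
  by lra.
(* Left of [A], the new [d] supplies the increment over the region and [clean' + acc'] the rest;
   between [A] and [B] those two channels are zero and the coding identity supplies everything. *)
- have [xA|/ltW Ax] := leP x A.
    rewrite corr0 // cleanl // big1 => [|j _]; last by rewrite v'0 ?mulr0.
    by have := fC _ _ AB; split; lra.
  rewrite corrE // cleanr //.
  have -> : \sum_(k < m') sigma' k * v' k = \sum_(j < m') sigma' j * relu (U j x).
    by apply: eq_bigr => j _; rewrite v'E.
  rewrite /E eE ?Ax //; have := fC _ _ xB.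
  by split; lra.
- have Ax : A <= x by apply: le_trans Bx.
  split; last exact: cleanr.
  rewrite corrE //.
  have -> : \sum_(k < m') sigma' k * v' k =
      \sum_(k < m') sigma' k * relu (x - t' k).
    by apply: eq_bigr => j _; rewrite v'E // UB.
  have xB0 : 0 <= x - B by rewrite subr_ge0.
  have := @sum_le_bound _ m' sigma' (fun k => relu (x - t' k)) _ xB0.
  have hb k : (k < m')%N -> 0 <= relu (x - t' k) <= x - B.
    by move=> _; rewrite relu_ge0 relu_le //; have := tB k; lra.
  move=> /(_ hb); rewrite ler_norml -/Ss => /andP[_ h1].
  have := ramp_sum_lip m e t Bx; rewrite ler_norml -/Se -/(E x) -/(E B) => /andP[h2 _].
  have h3 : 0 <= C * (x - B) by rewrite mulr_ge0.
  have h4 : 0 <= Sc * (x - B) by rewrite mulr_ge0.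
  by lra.
Qed.

(* Channels 0 to 4 are (x - A_b)_+, (A_b - x)_+, [corr], [clean] and [acc] of
   [layer_state]; the others are the double-role neurons. *)
Definition row5 (V : Type) (a0 a1 a2 a3 a4 : V) (c : nat -> V) (j : nat) : V :=
  match j with
  | 0 => a0 | 1 => a1 | 2 => a2 | 3 => a3 | 4 => a4
  | j'.+4.+1 => c j'
  end%N.

Lemma row5_sum (V : nmodType) (m : nat) (F : nat -> V) :
  \sum_(j < m.+4.+1) F j =
  F 0%N + F 1%N + F 2%N + F 3%N + F 4%N + \sum_(j < m) F j.+4.+1.
Proof. by rewrite 5!big_ord_recl /= !addrA. Qed.

Lemma row5_dot (R : realType) (m : nat) (a0 a1 a2 a3 a4 : R) (c : nat -> R)
    (b0 b1 b2 b3 b4 : R) (v : nat -> R) :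
  \sum_(j < m.+4.+1) row5 a0 a1 a2 a3 a4 c j * row5 b0 b1 b2 b3 b4 v j =
  a0 * b0 + a1 * b1 + a2 * b2 + a3 * b3 + a4 * b4 + \sum_(j < m) c j * v j.
Proof.
by rewrite (row5_sum _
  (fun j => row5 a0 a1 a2 a3 a4 c j * row5 b0 b1 b2 b3 b4 v j)).
Qed.

(** * Layers as matrices, their evaluation and parameter count *)

Lemma eval_hidden (R : realType) (d h : nat) (w : nat -> nat -> R)
    (b g g' : nat -> R) (Phi : relu_mlp R 1 h) :
  (forall i, (i < h)%N -> relu (\sum_(j < d) w i j * g j + b i) = g' i) ->
  mlp_eval (Hidden (\matrix_(i < h, j < d) w i j) (\col_i b i) Phi) (\col_j g j)
  = mlp_eval Phi (\col_i g' i).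
Proof.
move=> gE /=; congr mlp_eval; apply/matrixP => i j; rewrite !mxE -gE //.
by congr (relu (_ + _)); apply: eq_bigr => k _; rewrite !mxE.
Qed.

Lemma eval_output (R : realType) (d : nat) (w g : nat -> R) (b : R) :
  mlp_eval (Output (\matrix_(i < 1, j < d) w j) (\col_(i < 1) b)) (\col_j g j) 0 0
  = \sum_(j < d) w j * g j + b.
Proof.
by rewrite /= !mxE; congr (_ + _); apply: eq_bigr => k _; rewrite !mxE.
Qed.

Lemma mx_nnzE (R : realType) (p d : nat) (w : nat -> nat -> R) :
  mx_nnz (\matrix_(i < p, j < d) w i j) =
  (\sum_(i < p) \sum_(j < d) (w i j != 0%R))%N.
Proof.
rewrite /mx_nnz -sum1_card pair_big /= big_mkcond /=.
by apply: eq_bigr => -[i j] _; rewrite inE /= mxE; case: (_ != 0).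
Qed.

Lemma mx_nnz_le (R : realType) (p d : nat) (M : 'M[R]_(p, d)) :
  (mx_nnz M <= p * d)%N.
Proof.
by rewrite /mx_nnz (leq_trans (max_card _)) // card_prod !card_ord.
Qed.

Lemma mx_nnz_row5_le (R : realType) (m m' : nat) (r0 r1 r2 r3 r4 : nat -> R)
    (a1 : R) (c : nat -> nat -> R) :
  (mx_nnz (\matrix_(i < m'.+4.+1, j < m.+4.+1)
     (row5 r0 r1 r2 r3 r4 (fun j => row5 0 a1 0 0 0 (c j)) i j)%R)
   <= 5 * m.+4.+1 + m' + \sum_(j < m') \sum_(i < m) (c j i != 0%R))%N.
Proof.
pose w : nat -> nat -> R := row5 r0 r1 r2 r3 r4 (fun j => row5 0 a1 0 0 0 (c j)).
rewrite (mx_nnzE _ _ w).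
have bd i : (\sum_(j < m.+4.+1) (w i j != 0%R) <= m.+4.+1)%N.
  rewrite -[leqRHS]muln1 -[X in (X * _)%N]card_ord -sum_nat_const.
  by apply: leq_sum => j _; case: (_ != 0).
rewrite (row5_sum _ (fun i => \sum_(j < m.+4.+1) (w i j != 0%R)))%N.
have h : (\sum_(j < m') \sum_(i < m.+4.+1) (w j.+4.+1 i != 0%R) <=
    m' + \sum_(j < m') \sum_(i < m) (c j i != 0%R))%N.
  rewrite -[X in (X + _)%N]muln1 -[X in (X * _ + _)%N]card_ord -sum_nat_const.
  rewrite -big_split /=; apply: leq_sum => j _.
  rewrite (row5_sum _ (fun i => nat_of_bool (w j.+4.+1 i != 0%R))) /w /=.
  by rewrite eqxx /= leq_add2r; case: (_ != 0).
have := bd 0%N; have := bd 1%N; have := bd 2%N; have := bd 3%N; have := bd 4%N.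
move: h; rewrite -[GRing.add]/addn; set s := bigop _ _ _; clearbody s.
lia.
Qed.

(* By induction from the last layer backwards.  [C] is quantified after [C0]
   since it has to suit all regions, and [sigma], [d] and [Lam] after [t] since
   the preceding region chooses them knowing [t]. *)
Lemma net_exists (R : realType) (f : R -> R) (Lf : R) (A : nat -> R)
    (m ks : nat -> nat) (L l b : nat) :
  (forall x z, x <= z -> `|f z - f x| <= Lf * (z - x)) ->
  (b + l = L)%N ->
  (forall i, (b <= i < L)%N ->
     A i <= A i.+1 /\ codable f (A i) (A i.+1) (m i) (m i.+1) (ks i)) ->
  exists (t : nat -> R) (C0 : R), (forall i, A b <= t i) /\
  forall (C d : R) (sigma : nat -> R) (Lam : R), C0 <= C -> 0 <= Lam ->
  exists Phi : relu_mlp R 1 (m b).+4.+1,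
    [/\ widthvec Phi = rcons [seq (m i).+4.+1 | i <- iota b.+1 l] 8,
        (nb_nonzero_params Phi + 4 * (m b).+4.+1 <=
          2 * (\sum_(b <= i < L) ks i) +
          12 * (\sum_(b <= i < L.+1) (m i).+4.+1) + 17)%N
      & forall x corr clean acc v,
          layer_state f (A b) (m b) t C d sigma Lam x corr clean acc v ->
          mlp_eval Phi (\col_j row5 (relu (x - A b)) (relu (A b - x))
            corr clean acc v j) 0 0 = f (Num.min x (A L))].
Proof.
move=> fL; elim: l b => [|l IH] b.
  rewrite addn0 => <- _; exists (fun=> A b), Lf; split=> // C d sigma Lam LC Lam0.
  (* The nonzero rows compute [(A b - x)_+], the cleaned [r] and [clean + acc]; the other five rows
     are zero. *)
  pose w : nat -> nat -> R := row5 (row5 0 1 0 0 0 (fun=> 0))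
    (row5 (- Lam) 0 (-1) 0 0 sigma)
    (row5 0 0 0 1 1 (fun=> 0)) (fun=> 0) (fun=> 0) (fun _ => (fun=> 0 : R)).
  pose bb : nat -> R := row5 0 d 0 0 0 (fun=> 0).
  pose o : nat -> R := row5 C (-1) (-1) 0 0 (fun=> 0).
  exists (Hidden (\matrix_(i < 8, j < (m b).+4.+1) w i j) (\col_i bb i)
    (Output (\matrix_(i < 1, j < 8) o j) (\col_(i < 1) f (A b)))); split.
  - by [].
  - rewrite /= big_nat1 big_geq //.
    (* With [h] the width of layer [b], [8 * h + 8 + 8 + 1] parameters plus the reserve [4 * h] make
       [12 * h + 17]. *)
    have := mx_nnz_le (\matrix_(i < 8, j < (m b).+4.+1) w i j).
    have := mx_nnz_le (\col_(i < 8) bb i).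
    have := mx_nnz_le (\matrix_(i < 1, j < 8) o j).
    have := mx_nnz_le (\col_(i < 1) f (A b)).
    by move: (mx_nnz _) (mx_nnz _) (mx_nnz _) (mx_nnz _) => n1 n2 n3 n4; lia.
  move=> x corr clean acc v [vr vl rl rr [cl0 ac0]].
  set g := row5 _ _ corr clean acc v.
  set r := d - corr + _ in rl rr.
  rewrite (@eval_hidden _ _ _ w bb g (row5 (relu (A b - x))
     (relu (r - Lam * relu (x - A b))) (clean + acc) 0 0 (fun=> 0))); last first.
    move=> i _; rewrite /w /bb /g.
    have z0 (h : nat -> R) n : \sum_(j < n) (fun=> 0) j * h j = 0 :> R.
      by rewrite big1 // => j _; rewrite mul0r.
    case: i => [|[|[|[|[|i]]]]] /=; rewrite ?z0 ?row5_dot ?z0 ?addr0.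
    - by rewrite -[RHS](relu_id (relu_ge0 _)); congr relu; ring.
    - by congr relu; rewrite /r; ring.
    - rewrite -[RHS]relu_id ?addr_ge0 //; congr relu; ring.
    - by rewrite relu_eq0.
    - by rewrite relu_eq0.
    - by rewrite relu_eq0.
  rewrite eval_output row5_dot big1 => [|j _]; last by rewrite mul0r.
  have [xA|/ltW Ax] := leP x (A b).
    have [r0 h] := rl xA.
    rewrite [relu (A b - x)]relu_id ?subr_ge0 // [relu (x - _)]relu_eq0 ?subr_le0 //.
    rewrite mulr0 subr0 relu_id //.
    have -> : f x = f (A b) + C * (A b - x) - (r + (clean + acc)) by rewrite h; ring.
    ring.
  have [r0 h] := rr Ax.
  rewrite [relu (A b - x)]relu_eq0 ?subr_le0 // [relu (x - _)]relu_id ?subr_ge0 //.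
  rewrite relu_eq0 ?subr_le0 // h; ring.
move=> bl hyp.
have bL : (b < L)%N by lia.
have [||t' [C0' [t'A net']]] := IH b.+1; first by rewrite addSnnS.
  by move=> i ib; apply: hyp; lia.
have [|AB [t [tA tP]]] := hyp b; first by rewrite leqnn.
have [c [beta [sigma' [e [b0 UB eE cn]]]]] := tP t' t'A.
pose Se : R := \sum_(i < m b) `|e i|.
pose Sc : R := \sum_(j < m b.+1) \sum_(i < m b) `|c j i|.
pose Ss : R := \sum_(j < m b.+1) `|sigma' j|.
exists t, (Num.max C0' (Num.max Lf Se)); split=> // C d sigma Lam.
rewrite !ge_max => /and3P[CC0 LC SeC] Lam0.
have Lam'0 : 0 <= Sc + Se + Ss.
  by rewrite !addr_ge0 ?sumr_ge0 // => j _; apply: sumr_ge0.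
pose d' := f (A b.+1) + C * A b.+1 - f (A b) - C * A b.
have [Phi [Phiw Phin PhiE]] := net' C d' sigma' _ CC0 Lam'0.
pose K := Lam * (Sc + Se).
pose w : nat -> nat -> R := row5 (row5 1 (-1) 0 0 0 (fun=> 0))
  (row5 (-1) 1 0 0 0 (fun=> 0))
  (row5 C (- K) 0 0 0 e) (row5 (- Lam) 0 (-1) 0 0 sigma)
  (row5 0 0 0 1 1 (fun=> 0)) (fun j => row5 0 (- K) 0 0 0 (c j)).
(* Since [(x - A b)_+ - (A b - x)_+ = x - A b], the first two biases recentre these channels at
   [A b.+1]. *)
pose bb : nat -> R := row5 (A b - A b.+1) (A b.+1 - A b) 0 d 0 beta.
exists (Hidden (\matrix_(i < (m b.+1).+4.+1, j < (m b).+4.+1) w i j)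
  (\col_i bb i) Phi); split.
- by rewrite /= Phiw.
(* The reserve in the induction hypothesis, four times the width of layer [b.+1], pays for its
   biases and for three weights per double-role row. *)
- rewrite /= (@big_ltn _ _ _ b) // (@big_ltn _ _ _ b L.+1) ?ltnS 1?ltnW //.
  have := mx_nnz_row5_le (m b) (m b.+1) (row5 1 (-1) 0 0 0 (fun=> 0))
    (row5 (-1) 1 0 0 0 (fun=> 0)) (row5 C (- K) 0 0 0 e)
    (row5 (- Lam) 0 (-1) 0 0 sigma) (row5 0 0 0 1 1 (fun=> 0)) (- K) c.
  rewrite -/w.
  have := mx_nnz_le (\col_(i < (m b.+1).+4.+1) bb i).
  move: cn Phin.
  move: (mx_nnz _) (mx_nnz _) (nb_nonzero_params Phi) => n1 n2 n3.
  set s1 := (\sum_(j < _) _)%N; set s2 := (\sum_(b.+1 <= i < L) _)%N.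
  set s3 := (\sum_(b.+1 <= i < L.+1) _)%N.
  clearbody s1 s2 s3.
  clear; lia.
move=> x corr clean acc v st.
have := layer_state_step fL AB tA t'A b0 UB eE LC SeC Lam0 st.
rewrite -/Se -/Sc -/Ss -/K -/d' => /PhiE <-; congr (fun_of_matrix _ 0 0).
apply: eval_hidden => i _; rewrite /w /bb.
have z0 (h : nat -> R) n : \sum_(j < n) 0 * h j = 0 :> R.
  by rewrite big1 // => j _; rewrite mul0r.
have px : relu (x - A b) - relu (A b - x) = x - A b.
  have [xA|/ltW Ax] := leP x (A b).
    by rewrite relu_eq0 ?relu_id ?subr_ge0 ?subr_le0 //; ring.
  by rewrite relu_id ?[relu (A b - x)]relu_eq0 ?subr_ge0 ?subr_le0 //; ring.
case: i => [|[|[|[|[|i]]]]] /=; rewrite row5_dot ?z0; congr relu.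
- lra.
- lra.
- ring.
- ring.
- ring.
- ring.
Qed.

(** * The interpolant and the assembly of the network *)

Lemma pl_interpolant (R : realType) (k : nat) (x y : nat -> R) :
  (forall i, (i < k)%N -> x i < x i.+1) ->
  exists (f : R -> R) (Lf : R),
    [/\ forall u z, u <= z -> `|f z - f u| <= Lf * (z - u),
        forall i, (i <= k)%N -> f (x i) = y i
      & forall i, (i < k)%N -> affine_on f `[x i, x i.+1]].
Proof.
move=> xI; have le_x := incr_le xI.
suff [c cE] : exists c : nat -> R, forall i, (i <= k)%N ->
    y 0%N + \sum_(j < k) c j * relu (x i - x j) = y i.
  exists (fun z => y 0%N + \sum_(j < k) c j * relu (z - x j)).
  exists (\sum_(j < k) `|c j|); split=> // [u z uz|i ik].
    by rewrite opprD addrACA subrr add0r; apply: ramp_sum_lip.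
  have h0 : affine_on (fun z => 0 * z + y 0%N) `[x i, x i.+1] by exists 0, (y 0%N).
  have h : affine_on (fun z => \sum_(j < k) c j * relu (z - x j)) `[x i, x i.+1].
    apply: affine_on_sum => j _; apply/affine_onZ/affine_on_ramp.
    by have [ji|ij] := leqP j i; [left|right]; apply: le_x; have := ltn_ord j; lia.
  by apply: eq_affine_on (affine_onD h0 h) => z _; rewrite mul0r add0r.
elim: k xI le_x => [|k IH] xI le_x.
  by exists (fun=> 0) => i; rewrite leqn0 => /eqP ->; rewrite big_ord0 addr0.
have [i ik|i j ijk|c cE] := IH; first exact/xI/ltnW.
  by apply: le_x; lia.
have d0 : x k.+1 - x k != 0 by rewrite subr_eq0 gt_eqF ?xI.
pose ck := (y k.+1 - (y 0%N + \sum_(j < k) c j * relu (x k.+1 - x j)))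
  / (x k.+1 - x k).
exists (fun j => if (j < k)%N then c j else ck) => i ik.
rewrite big_ord_recr /= ltnn; under eq_bigr => j _ do rewrite ltn_ord.
move: ik; rewrite leq_eqVlt => /predU1P[->|ik].
  rewrite [relu (x k.+1 - x k)]relu_id ?subr_ge0 ?le_x ?leqnSn ?leqnn //.
  by rewrite /ck divfK //; ring.
rewrite [relu (x i - x k)]relu_eq0 ?mulr0 ?addr0 ?cE // subr_le0.
by apply: le_x; lia.
Qed.

Lemma sumn_diff (s : nat -> nat) (a b : nat) :
  (a <= b)%N -> (forall i, (a <= i < b)%N -> (s i <= s i.+1)%N) ->
  (s a + \sum_(a <= i < b) (s i.+1 - s i) = s b)%N.
Proof.
move=> ab; rewrite -(subnKC ab); elim: (b - a)%N => [|l IH] sI.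
  by rewrite addn0 big_geq // addn0.
rewrite addnS big_nat_recr ?leq_addr //= addnA IH => [|i il]; last first.
  by apply: sI; lia.
by rewrite subnKC // sI //; lia.
Qed.

Theorem theorem7p1 (R : realType) (K L : nat) (x y : nat -> R) (n : nat -> nat)
  (K_gt0 : (0 < K)%N)
  (L_ge3 : (3 <= L)%N)
  (x_incr : forall i : nat, (1 <= i < K)%N -> x i < x i.+1)
  (n_gt11 : forall b : nat, (1 <= b <= L)%N -> (11 < n b)%N)
  (K_le : K%:Z <=
    \sum_(1 <= b < L)
      (((n b)%:Z - 11) * (((n b.+1)%:Z - 9) %/ 4)%Z - 2)) :
  exists Phi : relu_mlp R 1 1,
    [/\ widthvec Phi = rcons [seq n b | b <- iota 1 L] 8%N,
        forall i : nat, (1 <= i <= K)%N -> mlp_fun Phi (x i) = y i,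
        forall i : nat, (1 <= i < K)%N ->
          affine_on (mlp_fun Phi) `[x i, x i.+1],
        constant_on (mlp_fun Phi) `]-oo, x 1%N] /\
        constant_on (mlp_fun Phi) `[x K, +oo[
      & (nb_nonzero_params Phi)%:Z <=
          2 * K%:Z + 23 * \sum_(1 <= b < L.+1) (n b)%:Z - 121 * L%:Z].
Proof.
have xI i : (i < K.-1)%N -> x i.+1 < x i.+2 by move=> iK; apply: x_incr; lia.
have x_le i j : (1 <= i <= j)%N -> (j <= K)%N -> x i <= x j.
  case: i j => [//|i] [|j] // ij jK.
  by apply: (@incr_le _ K.-1 (fun i => x i.+1)) => //; lia.
have [f [Lf [fL fx fA]]] := @pl_interpolant _ K.-1 _ (fun i => y i.+1) xI.
(* Truncated subtraction only increases a summand: where the integer one is negative, this one is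
   0. *)
pose cap b := ((n b - 11) * ((n b.+1 - 9) %/ 4) - 2)%N.
have capK : (K <= \sum_(1 <= b < L) cap b)%N.
  rewrite -lez_nat (le_trans K_le) //.
  rewrite (big_morph Posz PoszD (erefl _)) !big_nat; apply: ler_sum => b bL.
  have nb : (11 < n b)%N by apply: n_gt11; lia.
  have nb' : (11 < n b.+1)%N by apply: n_gt11; lia.
  have -> : (n b)%:Z - 11 = (n b - 11)%N by lia.
  have -> : (n b.+1)%:Z - 9 = (n b.+1 - 9)%N by lia.
  rewrite divz_nat -PoszM /cap; set p := (_ * _)%N; lia.
(* Index of the data point at which region [b] starts; it stays at [K] once the data are
   exhausted. *)
pose s b := minn K (1 + \sum_(1 <= i < b) cap i)%N.
have sS b : (0 < b)%N -> (s b <= s b.+1 <= s b + cap b)%N.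
  by move=> b0; rewrite /s big_nat_recr //=; lia.
have s1 : s 1%N = 1%N by rewrite /s big_geq // addn0; lia.
have sL : s L = K by rewrite /s; lia.
have s_pos b : (0 < s b)%N by rewrite /s; lia.
have sK b : (s b <= K)%N by rewrite /s geq_minl.
pose ks b := (s b.+1 - s b)%N.
have ksE : (1 + \sum_(1 <= i < L) ks i = K)%N.
  rewrite -sL -[X in (X + _)%N]s1 sumn_diff //; first lia.
  by move=> i /andP[i0 _]; have /andP[] := sS i i0.
pose A b := x (s b).
pose m b := (n b - 5)%N.
have mE b : (1 <= b <= L)%N -> (m b).+4.+1 = n b.
  by move=> /n_gt11; rewrite /m; lia.
have step i : (1 <= i < L)%N ->
    A i <= A i.+1 /\ codable f (A i) (A i.+1) (m i) (m i.+1) (ks i).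
  move=> /andP[i0 iL]; have /andP[sii siic] := sS i i0.
  split; first by apply: x_le; rewrite ?s_pos.
  have nb : (11 < n i)%N by apply: n_gt11; lia.
  have nb' : (11 < n i.+1)%N by apply: n_gt11; lia.
  have [k0|kpos] := posnP (ks i).
    rewrite k0; have -> : A i.+1 = A i by rewrite /A; congr x; rewrite /ks in k0; lia.
    by apply: codable_pt; rewrite /m; lia.
  have sE : s i.+1 = (s i + ks i)%N by rewrite /ks; lia.
  have -> : A i.+1 = x (s i + ks i)%N by rewrite /A sE.
  have -> : A i = x (s i + 0)%N by rewrite /A addn0.
  have skK : (s i + ks i <= K)%N by rewrite -sE.
  apply: (@codable_interval _ _ (fun j => x (s i + j)%N) (n i - 11)
    ((n i.+1 - 9) %/ 4)).
  - by rewrite kpos /=; move: siic; rewrite sE leq_add2l /cap; lia.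
  - by rewrite /m; lia.
  - by rewrite (leq_trans (leq_divM _ _)) // /m; lia.
  - by move=> j jk; rewrite addnS; apply: x_incr; have := s_pos i; lia.
  - move=> j jk; rewrite addnS -(prednK (s_pos i)) addSn; apply: fA.
    by have := s_pos i; lia.
have [|t [C0 [tA net]]] := net_exists (b := 1) (l := L.-1) (m := m) fL _ step.
  by lia.
have [Phi [Phiw Phin PhiE]] := net C0 0 (fun=> 0) 0 (lexx _) (lexx _).
(* The channel for [(A 1 - x)_+] is set to 0, so the rest of the network sees [Num.max z (A 1)]
   instead of [z]; this makes the function constant left of the data. *)
pose w : nat -> nat -> R := fun i _ => row5 1 0 0 0 0 (fun=> 1) i.
pose bb : nat -> R := row5 (- A 1%N) 0 0 0 0 (fun k => - t k).
pose Psi := Hidden (\matrix_(i < (m 1%N).+4.+1, j < 1) w i j) (\col_i bb i) Phi.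
have PsiE z : mlp_fun Psi z = f (Num.min (Num.max z (x 1%N)) (x K)).
  rewrite /mlp_fun; have -> : const_mx z = \col_(j < 1) (fun=> z) (j : nat).
    by apply/matrixP => i j; rewrite !mxE.
  pose u := Num.max z (A 1%N).
  have uA : A 1%N <= u by rewrite /u le_max lexx orbT.
  have uE c : A 1%N <= c -> relu (z - c) = relu (u - c).
    rewrite /u => Ac; have [zA|//] := ltP z (A 1%N).
    by rewrite !relu_eq0 //; lra.
  have st : layer_state f (A 1%N) (m 1%N) t C0 0 (fun=> 0) 0 u 0 0 0
      (fun k => relu (z - t k)).
    rewrite /layer_state; have -> : \sum_(k < m 1%N) 0 * relu (z - t k) = 0 :> R.
      by rewrite big1 // => k _; rewrite mul0r.
    split=> [_ k _|uA' k _|uA'|_|//]; first exact: uE.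
    - by rewrite uE // relu_eq0 ?mul0r ?lexx // subr_le0 (le_trans uA').
    - by have -> : u = A 1%N by [apply/le_anti; rewrite uA uA']; split; lra.
    - by split; lra.
  have := PhiE _ _ _ _ _ st; rewrite /A s1 sL -/(A 1%N) => hE.
  rewrite /u /A s1 in hE; rewrite -hE; congr (fun_of_matrix _ 0 0).
  apply: eval_hidden => i _; rewrite big_ord1 /w /bb.
  have xA : x 1%N = A 1%N by rewrite /A s1.
  have relu0 : relu (0 : R) = 0 by apply: relu_eq0.
  case: i => [|[|[|[|[|i]]]]] /=; rewrite ?mul0r ?addr0 ?mul1r ?relu0 //.
  - by rewrite uE // xA.
  - by rewrite xA relu_eq0 // subr_le0.
exists Psi; split.
- rewrite /= Phiw mE; last lia.
  rewrite -rcons_cons; congr rcons; case: (L) L_ge3 mE => // L' _ mE' /=.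
  congr (_ :: _); apply/eq_in_map => b; rewrite mem_iota => bL.
  by apply: mE'; lia.
- move=> i iK; rewrite PsiE.
  have h1 : x 1%N <= x i by apply: x_le; lia.
  have h2 : x i <= x K by apply: x_le; lia.
  rewrite (max_idPl h1) (min_idPl h2) -(@prednK i); last lia.
  by apply: fx; lia.
- move=> i iK; have fAi : affine_on f `[x i, x i.+1].
    by rewrite -(@prednK i); [apply: fA; lia|lia].
  apply: eq_affine_on fAi => z /andP[z1 z2]; rewrite PsiE.
  have h1 : x 1%N <= z by apply: le_trans z1; apply: x_le; lia.
  have h2 : z <= x K by apply: (le_trans z2); apply: x_le; lia.
  by rewrite (max_idPl h1) (min_idPl h2).
- split.
    exists (f (Num.min (x 1%N) (x K))) => z; rewrite in_itv /= => z1.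
    by rewrite PsiE (max_idPr z1).
  exists (f (x K)) => z; rewrite in_itv /= andbT => z1; rewrite PsiE.
  by congr f; apply/min_idPr; rewrite le_max z1.
- have -> : \sum_(1 <= b < L.+1) (n b)%:Z = (\sum_(1 <= b < L.+1) n b)%N.
    by rewrite (big_morph Posz PoszD (erefl _)).
  have SE : (\sum_(1 <= b < L.+1) (m b).+4.+1 = \sum_(1 <= b < L.+1) n b)%N.
    by apply: eq_big_nat => b bL; apply: mE; lia.
  (* Gives [11 * \sum n b - 121 * L >= 11 * L], room for the additive constants on top of
     [12 * \sum n b]. *)
  have S12 : (12 * L <= \sum_(1 <= b < L.+1) n b)%N.
    have -> : (12 * L = \sum_(1 <= b < L.+1) 12)%N.
      by rewrite sum_nat_const_nat subn1 mulnC.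
    by rewrite !big_nat; apply: leq_sum => b bL; apply: n_gt11; lia.
  rewrite /=; have := mx_nnz_le (\matrix_(i < (m 1%N).+4.+1, j < 1) w i j).
  have := mx_nnz_le (\col_(i < (m 1%N).+4.+1) bb i).
  move: Phin S12 ksE; rewrite SE.
  move: (mx_nnz _) (mx_nnz _) (nb_nonzero_params Phi) => n1 n2 n3.
  set s2 := (\sum_(1 <= i < L) _)%N; set s3 := (\sum_(1 <= i < L.+1) _)%N.
  clearbody s2 s3; move: (m 1%N) L_ge3; clear; lia.
Qed.
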